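(* Let $\mathcal{X}$ be a finite simplicial complex with vertex set $I$. (1) If $H^1(\mathcal{X},\mathbb{R})=0$, then for any collection of agents indexed by $I$ whose overlap simplicial complex is $\mathcal{X}$, the agents have an ur-prior if and only if they are pairwise compatible. (2) If $H^1(\mathcal{X},\mathbb{R})\neq 0$, then there exists a collection of agents indexed by $I$ whose overlap simplicial complex is $\mathcal{X}$ that is pairwise compatible but has no ur-prior.
   Context: Agents. Let $I$ be a finite set. A collection of agents indexed by $I$ consists of a measurable space $A$ and, for each $i\in I$, a measurable subset $A_i\subseteq A$ together with a probability measure $P_i$ on $A_i$ (the credence function of agent $i$; $A_i$ carries the $\sigma$-algebra inherited from $A$). For a probability measure $P$ and a measurable set $C$ with $P(C)>0$, the conditionalization of $P$ on $C$ is $P|_C(B)=P(B\cap C)/P(C)$ for measurable $B$. Ur-prior. An ur-prior for $(P_i)_{i\in I}$ is a probability measure $P$ on $\bigcup_{i\in I}A_i$ such that for each $i\in I$ one has $P|_{A_i}=P_i$ (in particular $P(A_i)>0$, so that the conditionalization is defined). Pairwise compatibility. The agents are pairwise compatible if for all $i,j\in I$: whenever $P_i(A_i\cap A_j)$ and $P_j(A_i\cap A_j)$ are both positive, then $P_i|_{A_i\cap A_j}=P_j|_{A_i\cap A_j}$ (as measures on $A_i\cap A_j$). Simplicial complex. A simplicial complex is a collection of non-empty finite sets closed under taking non-empty subsets. A simplicial complex on vertex set $I$ consists of non-empty subsets of $I$ and contains every singleton $\{i\}$, $i\in I$. Overlap simplicial complex. The overlap simplicial complex of a collection of agents indexed by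 $I$ is the simplicial complex on vertex set $I$ consisting of those non-empty subsets $J\subseteq I$ such that $P_j\bigl(\bigcap_{k\in J}A_k\bigr)>0$ for all $j\in J$. First cohomology. Fix an arbitrary total order on $I$. Let $\mathcal{X}_0=I$, let $\mathcal{X}_1$ be the set of pairs $(i,j)$ with $i<j$ and $\{i,j\}\in\mathcal{X}$, and let $\mathcal{X}_2$ be the set of triples $(i,j,k)$ with $i<j<k$ and $\{i,j,k\}\in\mathcal{X}$. For $f:\mathcal{X}_0\to\mathbb{R}$ define $\delta f:\mathcal{X}_1\to\mathbb{R}$ by $\delta f(i,j)=f(j)-f(i)$; for $g:\mathcal{X}_1\to\mathbb{R}$ define $\delta g:\mathcal{X}_2\to\mathbb{R}$ by $\delta g(i,j,k)=g(j,k)-g(i,k)+g(i,j)$. A function $g:\mathcal{X}_1\to\mathbb{R}$ is a cocycle if $\delta g=0$ and a coboundary if $g=\delta f$ for some $f:\mathcal{X}_0\to\mathbb{R}$. $H^1(\mathcal{X},\mathbb{R})$ is the quotient of the vector space of cocycles by the subspace of coboundaries; $H^1(\mathcal{X},\mathbb{R})=0$ means that every cocycle is a coboundary.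
   Formalization: I is assumed non-empty, and in (1) ''pairwise compatible'' is supplemented by: if P_i(A_i∩A_j)>0 then P_j(A_i∩A_j)>0 for all i,j. Without this (1) fails, e.g. A_1={a,b}, A_2={b}, P_1=δ_a, P_2=δ_b. The agents in (2) also satisfy this condition. *)

(* Defs.v *)
From HB Require Import structures.
From mathcomp Require Import all_boot all_order all_algebra.
From mathcomp Require Import all_classical all_reals all_analysis.

Set Implicit Arguments.
Unset Strict Implicit.
Unset Printing Implicit Defensive.

Import Order.TTheory GRing.Theory Num.Theory.

Local Open Scope ring_scope.

Record simplicial_complex (I : finType) := SimplicialComplex {
  simplices :> {set {set I}};
  simplex_nonempty : forall J : {set I}, J \in simplices -> (0 < #|J|)%N;
  simplex_face : forall J K : {set I},
    J \in simplices -> K \subset J -> (0 < #|K|)%N -> K \in simplices;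
  simplex_vertex : forall i : I, [set i]%SET \in simplices }.

Section Cohomology.
Context (R : realType) (disp : Order.disp_t) (I : finOrderType disp).
Variable X : simplicial_complex I.

Definition is_edge (e : I * I) : bool :=
  (e.1 < e.2)%O && ([set e.1; e.2]%SET \in simplices X).

Definition is_triangle (t : I * I * I) : bool :=
  [&& (t.1.1 < t.1.2)%O, (t.1.2 < t.2)%O
    & [set t.1.1; t.1.2; t.2]%SET \in simplices X].

Definition edge := {e : I * I | is_edge e}.
Definition triangle := {t : I * I * I | is_triangle t}.

Lemma is_edge12 (t : triangle) : is_edge ((val t).1.1, (val t).1.2).
Proof.
case: t => -[[i j] k] /= /and3P[/= ij jk tX]; rewrite /is_edge /= ij /=.
apply: (simplex_face tX); first exact: finset.subsetUl.
by rewrite card_gt0; apply/set0Pn; exists i; rewrite !inE eqxx.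
Qed.

Lemma is_edge13 (t : triangle) : is_edge ((val t).1.1, (val t).2).
Proof.
case: t => -[[i j] k] /= /and3P[/= ij jk tX].
rewrite /is_edge /= (lt_trans ij jk) /=; apply: (simplex_face tX).
  by apply/fintype.subsetP => x; rewrite !inE => /orP[] ->; rewrite ?orbT.
by rewrite card_gt0; apply/set0Pn; exists i; rewrite !inE eqxx.
Qed.

Lemma is_edge23 (t : triangle) : is_edge ((val t).1.2, (val t).2).
Proof.
case: t => -[[i j] k] /= /and3P[/= ij jk tX].
rewrite /is_edge /= jk /=; apply: (simplex_face tX).
  by apply/fintype.subsetP => x; rewrite !inE => /orP[] ->; rewrite ?orbT.
by rewrite card_gt0; apply/set0Pn; exists j; rewrite !inE eqxx.
Qed.

Definition face12 (t : triangle) : edge := Sub _ (is_edge12 t).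
Definition face13 (t : triangle) : edge := Sub _ (is_edge13 t).
Definition face23 (t : triangle) : edge := Sub _ (is_edge23 t).

Definition delta0 (f : I -> R) (e : edge) : R := f (val e).2 - f (val e).1.

Definition delta1 (g : edge -> R) (t : triangle) : R :=
  g (face23 t) - g (face13 t) + g (face12 t).

Definition cocycle (g : edge -> R) : Prop := forall t, delta1 g t = 0.

Definition coboundary (g : edge -> R) : Prop :=
  exists f : I -> R, forall e, g e = delta0 f e.

Definition H1_eq0 : Prop := forall g : edge -> R, cocycle g -> coboundary g.

End Cohomology.

Local Open Scope classical_set_scope.
Local Open Scope ereal_scope.

(* A probability measure on the measurable subset [dom i], with its trace
   sigma-algebra, is represented by the probability measure on the ambient
   space that gives [dom i] mass 1; two measures on a measurable set are equal
   when they agree on its measurable subsets.  A measurableType is pointed, so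
   the subtype of elements of [dom i] is not itself one in general. *)
Record agents (R : realType) (I : finType) := Agents {
  agents_display : measure_display;
  space : measurableType agents_display;
  dom : I -> set space;
  credence : I -> probability space R;
  measurable_dom : forall i, measurable (dom i);
  credence_dom : forall i, credence i (dom i) = 1 }.

Arguments dom {R I} ag i : rename.
Arguments credence {R I} ag i : rename.

(* Meaningful only when 0 < P C (the inverse of 0 in \bar R is +oo). *)
Definition conditional d (T : measurableType d) (R : realType)
    (P : probability T R) (C B : set T) : \bar R :=
  P (B `&` C) / P C.

Section Agents.
Context (R : realType) (I : finType).
Variable ag : agents R I.

Definition is_ur_prior (P : probability (space ag) R) : Prop :=
  P (\bigcup_(i in [set: I]) dom ag i) = 1 /\
  forall i, 0 < P (dom ag i) /\
    forall B, measurable B -> B `<=` dom ag i ->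
      conditional P (dom ag i) B = credence ag i B.

Definition has_ur_prior : Prop := exists P, is_ur_prior P.

Definition pairwise_compatible : Prop := forall i j : I,
  let D := dom ag i `&` dom ag j in
  0 < credence ag i D -> 0 < credence ag j D ->
  forall B, measurable B -> B `<=` D ->
    conditional (credence ag i) D B = conditional (credence ag j) D B.

(* [pairwise_compatible] imposes nothing on a pair when exactly one of the two
   agents gives the overlap positive probability, although such a pair never
   has an ur-prior: P(A_i `&` A_j) would have to be both zero and positive. *)
Definition overlap_positivity_symmetric : Prop := forall i j : I,
  let D := dom ag i `&` dom ag j in
  0 < credence ag i D -> 0 < credence ag j D.

Definition is_overlap_simplex (J : {set I}) : Prop :=
  (0 < #|J|)%N /\
  forall j, j \in J -> 0 < credence ag j (\bigcap_(k in [set` J]) dom ag k).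

Definition overlap_complex : {set {set I}} :=
  [set J : {set I} | `[< is_overlap_simplex J >]]%SET.

End Agents.

(* Main.v *)
(* Compatible agents [i], [j] disagree on their overlap only by the factor
   [P_i(A_i `&` A_j) / P_j(A_i `&` A_j)]; an ur-prior is a choice of weights
   [w i] for which the measures [w i * P_i] agree on overlaps.  The logarithms
   of these factors form a 1-cocycle of the overlap complex, because on a
   triangle they can all be computed on the triple overlap, and
   [w i = expR (f i)] works exactly when this cocycle is the coboundary of [f].
   Conversely, given a cocycle [g], take the simplices as points and let [A_i]
   be the set of simplices that contain [i].  On each simplex [J] one has
   [g = delta h_J], and giving [J] the mass [expR (- h_J i)] for agent [i], up
   to normalization, makes the logarithmic ratios cohomologous to [g]. *)
Require Import Defs.
From HB Require Import structures.
From mathcomp Require Import all_boot all_order all_algebra.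
From mathcomp Require Import all_classical all_reals all_analysis.
From mathcomp Require Import ring lra.

Set Implicit Arguments.
Unset Strict Implicit.
Unset Printing Implicit Defensive.

Import Order.TTheory GRing.Theory Num.Theory.

Local Open Scope classical_set_scope.
Local Open Scope ring_scope.

HB.instance Definition _ (I : finType) := isPointed.Build {set I} finset.set0.

(** * Real-valued masses and normalized mixtures *)

Section Mass.
Context d (T : measurableType d) (R : realType).
Implicit Types (P : probability T R) (B C : set T).

Definition mass P B : R := fine (P B).

Lemma massE P B : measurable B -> P B = (mass P B)%:E.
Proof. by move=> mB; rewrite /mass fineK// fin_num_measure. Qed.

Lemma mass_ge0 P B : 0 <= mass P B.
Proof. by rewrite /mass fine_ge0. Qed.

Lemma mass_gt0 P B : measurable B -> (0 < P B)%E = (0 < mass P B).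
Proof. by move=> mB; rewrite massE// lte_fin. Qed.

Lemma le_mass P B C : measurable B -> measurable C -> B `<=` C ->
  mass P B <= mass P C.
Proof.
by move=> mB mC BC; rewrite -lee_fin -!massE//; apply: le_measure; rewrite ?inE.
Qed.

Lemma conditional_mass P C B : measurable C -> measurable B -> B `<=` C ->
  (0 < P C)%E -> conditional P C B = (mass P B / mass P C)%:E.
Proof.
move=> mC mB BC PC; rewrite /conditional (setIidl BC) !massE//.
by rewrite inver gt_eqF// -mass_gt0.
Qed.

Lemma mass_bigcup P (I : finType) (F : I -> set T) :
  (forall i, measurable (F i)) -> trivIset setT F ->
  mass P (\bigcup_i F i) = \sum_i mass P (F i).
Proof.
move=> mF tF; apply: EFin_inj; rewrite -massE; last first.
  by apply: fin_bigcup_measurable => //; exact: finite_finset.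
rewrite measure_fin_bigcup//; last exact: finite_finset.
have -> : [set: I] = [set` xpredT] by apply/seteqP.
rewrite -(bigfs _ (r := index_enum I)) ?index_enum_uniq//; last first.
  by move=> i _; rewrite mem_index_enum.
by rewrite -sumEFin; apply: eq_bigr => i _; exact: massE.
Qed.

(** Builds both the glued ur-prior (credences cut along disjoint pieces) and the credences of the
    counterexample (Dirac masses, with no cut). *)
Lemma mixture (I : finType) (w : I -> R) (Q : I -> probability T R)
    (E : I -> set T) (s := fun B => \sum_i w i * mass (Q i) (B `&` E i)) :
  (forall i, 0 <= w i) -> (forall i, measurable (E i)) -> 0 < s setT ->
  exists P : probability T R,
    forall B, measurable B -> mass P B = s B / s setT.
Proof.
move=> w0 mE s0.
have [i0 _|I0] := pickP (@predT I); last first.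
  by move: s0; rewrite /s big_pred0 ?ltxx// => i; have := I0 i.
(* [msum] runs over natural numbers, so [I] is enumerated. *)
pose e := nth i0 (enum I).
pose m k : {measure set T -> \bar R} :=
  mscale (NngNum (w0 (e k))) (mrestr (Q (e k)) (mE (e k))).
pose mu : {measure set T -> \bar R} := msum m #|I|.
have muE B : measurable B -> mu B = (s B)%:E.
  move=> mB; rewrite /s -big_enum (big_nth i0) -cardE big_mkord -sumEFin.
  apply: eq_bigr => k _; rewrite /m/= /mscale/= /mrestr/= EFinM -massE//.
  exact: measurableI.
(* [Q i0] is only the fallback for a degenerate total mass, which [s0] excludes. *)
exists (mnormalize mu (Q i0)) => B mB.
rewrite {1}/mass/= /mnormalize muE// eqe gt_eqF//= muE//.
Qed.

End Mass.

Lemma bigcap_set2 T (I : finType) (F : I -> set T) i j :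
  \bigcap_(k in [set` [set i; j]%SET]) F k = F i `&` F j.
Proof.
apply/seteqP; split=> [x H|x [Fi Fj] k /=].
  by split; apply: H => /=; rewrite !inE eqxx ?orbT.
by rewrite !inE => /orP[]/eqP->.
Qed.

Lemma bigcap_set3 T (I : finType) (F : I -> set T) i j k :
  \bigcap_(l in [set` [set i; j; k]%SET]) F l = F i `&` F j `&` F k.
Proof.
apply/seteqP; split=> [x H|x [[Fi Fj] Fk] l /=].
  by split; first split; apply: H => /=; rewrite !inE eqxx ?orbT.
by rewrite !inE => /orP[/orP[]|]/eqP->.
Qed.

(** * Disjointing a finite cover: each point goes to its least index *)

Section DisjointPieces.
Context d (T : measurableType d) (disp : Order.disp_t) (I : finOrderType disp).
Variable A : I -> set T.
Hypothesis mA : forall i, measurable (A i).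

Definition disjoint_piece i := A i `\` \bigcup_(j in [set j | (j < i)%O]) A j.

Lemma measurable_disjoint_piece i : measurable (disjoint_piece i).
Proof.
apply: measurableD => //; apply: fin_bigcup_measurable => //.
exact: finite_finset.
Qed.

Lemma trivIset_disjoint_piece B :
  trivIset setT (fun i => B `&` disjoint_piece i).
Proof.
apply/trivIsetP => i j _ _ ij; wlog ltij : i j ij / (i < j)%O.
  move=> wl; case: (ltgtP i j) => [|ji|/eqP/(negP ij)//]; first exact: wl.
  by rewrite setIC; apply: wl; rewrite // eq_sym.
by apply/seteqP; split=> // x [[_ [Ax _]] [_ [_ /(_ (ex_intro2 _ _ i ltij Ax))]]].
Qed.

Lemma bigcup_disjoint_piece B : B `<=` \bigcup_i A i ->
  \bigcup_i (B `&` disjoint_piece i) = B.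
Proof.
move=> BA; apply/seteqP; split=> [x [i _ []]//|x Bx].
have [i _ Aix] := BA x Bx.
pose P j := `[< A j x >].
have Pi : P i by apply/asboolP.
case: (Order.TotalTheory.arg_minP (fun j => j) Pi) => k /asboolP Akx mink.
exists k => //; split=> //; split=> // -[j /= jk Ajx].
by have := mink j (asboolT Ajx); rewrite leNgt jk.
Qed.

End DisjointPieces.

(** * Consequences of an ur-prior, and gluing of weighted credences *)

Section UrPrior.
Context (R : realType) (disp : Order.disp_t) (I : finOrderType disp).
Variable ag : agents R I.

Local Notation A := (dom ag).
Local Notation p i := (mass (credence ag i)).

Let mA i : measurable (A i). Proof. exact: measurable_dom. Qed.
Let mAI i j : measurable (A i `&` A j). Proof. exact: measurableI. Qed.
Hint Resolve mA mAI : core.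

Lemma mass_dom i : p i (A i) = 1.
Proof. by rewrite /mass credence_dom. Qed.

Lemma conditional_eq_mass i j B :
  let D := A i `&` A j in
  (0 < credence ag i D)%E -> (0 < credence ag j D)%E ->
  measurable B -> B `<=` D ->
  (conditional (credence ag i) D B = conditional (credence ag j) D B) <->
  p i B * p j D = p j B * p i D.
Proof.
move=> D iD jD mB BD; have mD : measurable D by exact: mAI.
rewrite !conditional_mass//; move: iD jD; rewrite !mass_gt0// => iD jD.
split=> [[]/eqP|/eqP eq_cross].
  by rewrite eqr_div ?lt0r_neq0// => /eqP.
by congr (_%:E); apply/eqP; rewrite eqr_div ?lt0r_neq0.
Qed.

Lemma ur_prior_massE P : is_ur_prior P ->
  forall i, 0 < mass P (A i) /\ forall B, measurable B -> B `<=` A i ->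
    p i B = mass P B / mass P (A i).
Proof.
move=> [_ Pcond] i; have [P0 PE] := Pcond i; rewrite -mass_gt0//.
split=> // B mB BA.
by apply: EFin_inj; rewrite -massE// -PE// conditional_mass.
Qed.

(** After cross-multiplication both sides are P(B) P(D) / (P(A_i) P(A_j)). *)
Lemma ur_prior_pairwise_compatible : has_ur_prior ag -> pairwise_compatible ag.
Proof.
move=> [P /ur_prior_massE uP] i j D iD jD B mB BD.
apply/conditional_eq_mass => //.
have [i0 iE] := uP i; have [j0 jE] := uP j.
have Bi : B `<=` A i by move=> x /BD[].
have Bj : B `<=` A j by move=> x /BD[].
rewrite !iE ?jE//; try by move=> x [].
by ring.
Qed.

Lemma ur_prior_overlap_positivity_symmetric :
  has_ur_prior ag -> overlap_positivity_symmetric ag.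
Proof.
move=> [P /ur_prior_massE uP] i j D.
have [i0 iE] := uP i; have [j0 jE] := uP j.
have mD : measurable D by exact: mAI.
rewrite !mass_gt0// iE ?jE//; try by move=> x [].
by rewrite !pmulr_lgt0 ?invr_gt0.
Qed.

(** The measures [w i * p i] agree on overlaps, so they are restrictions of one finite measure [s].
    Conditioning its normalization on [A i] cancels both [w i] and the total mass. *)
Lemma glued_ur_prior (w : I -> R) : (0 < #|I|)%N ->
  (forall i, 0 < w i) ->
  (forall i j B, measurable B -> B `<=` A i `&` A j ->
    w i * p i B = w j * p j B) ->
  has_ur_prior ag.
Proof.
move=> /card_gt0P[i0 _] w0 agree.
pose E := disjoint_piece A.
have mE i : measurable (E i) by exact: measurable_disjoint_piece.
have EA i : E i `<=` A i by move=> x [].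
pose s B := \sum_i w i * p i (B `&` E i).
(* Inside [A k], agreement replaces the measure used on each piece by that of agent [k]. *)
have sE k B : measurable B -> B `<=` A k -> s B = w k * p k B.
  move=> mB BA; rewrite -[in RHS](@bigcup_disjoint_piece _ _ _ _ A B); last first.
    by move=> x /BA Ax; exists k.
  rewrite mass_bigcup; last 2 first.
  - by move=> i; exact: measurableI.
  - exact: trivIset_disjoint_piece.
  rewrite mulr_sumr; apply: eq_bigr => i _; apply: agree.
    exact: measurableI.
  by move=> x [Bx /EA Ax]; split=> //; exact: BA.
have sT0 : 0 < s setT.
  apply: (@lt_le_trans _ _ (s (A i0))); first by rewrite (sE i0)// mass_dom mulr1.
  apply: ler_sum => i _; apply: ler_wpM2l; first exact: ltW.
  by apply: le_mass => [||x []//]; apply: measurableI.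
have [P PE] := mixture (fun i => ltW (w0 i)) mE sT0.
have {}PE B : measurable B -> mass P B = s B / s setT by exact: PE.
exists P; split.
  have mU : measurable (\bigcup_i A i).
    by apply: fin_bigcup_measurable => //; exact: finite_finset.
  rewrite massE// PE//; congr (_%:E).
  suff -> : s (\bigcup_i A i) = s setT by rewrite divff// gt_eqF.
  apply: eq_bigr => i _; congr (_ * mass _ _).
  by rewrite setTI; apply/setIidr => x /EA Ax; exists i.
move=> i; have PA : mass P (A i) = w i / s setT.
  by rewrite PE// (sE i)// mass_dom mulr1.
have PA0 : (0 < P (A i))%E by rewrite mass_gt0// PA divr_gt0.
split=> // B mB BA; rewrite conditional_mass// massE//; congr (_%:E).
rewrite PA PE// (sE i)//.
by field; rewrite !gt_eqF.
Qed.

(** * The logarithmic cocycle and sufficiency of vanishing cohomology *)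

Variable X : simplicial_complex I.
Hypothesis agX : overlap_complex ag = simplices X.

Lemma overlap_complexP (J : {set I}) :
  reflect (is_overlap_simplex ag J) (J \in simplices X).
Proof. by rewrite -agX inE; exact: asboolP. Qed.

Hypothesis comp : pairwise_compatible ag.

Lemma pairwise_compatible_mass i j B :
  0 < p i (A i `&` A j) -> 0 < p j (A i `&` A j) ->
  measurable B -> B `<=` A i `&` A j ->
  p i B * p j (A i `&` A j) = p j B * p i (A i `&` A j).
Proof.
move=> iD jD mB BD; apply/conditional_eq_mass => //; rewrite ?mass_gt0//.
by apply: comp; rewrite ?mass_gt0.
Qed.

(** The sign is such that [delta0 f] takes this value at an edge when the weights [expR (f i)]
    equalize the two masses of the overlap. *)
Definition log_overlap_ratio (e : edge X) : R :=
  let: (i, j) := val e in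
  ln (p i (A i `&` A j)) - ln (p j (A i `&` A j)).

(** Compatibility makes the ratio the same on every charged part of the overlap, so the three edges
    of a triangle can be evaluated on one set. *)
Lemma log_overlap_ratio_sub i j B (e : edge X) : val e = (i, j) ->
  measurable B -> B `<=` A i `&` A j -> 0 < p i B -> 0 < p j B ->
  log_overlap_ratio e = ln (p i B) - ln (p j B).
Proof.
move=> eE mB BD iB jB; rewrite /log_overlap_ratio eE.
have iD : 0 < p i (A i `&` A j) by apply: (lt_le_trans iB); exact: le_mass.
have jD : 0 < p j (A i `&` A j) by apply: (lt_le_trans jB); exact: le_mass.
have /(congr1 (@ln R)) := pairwise_compatible_mass iD jD mB BD.
by rewrite !lnM ?posrE//; lra.
Qed.

Lemma cocycle_log_overlap_ratio : cocycle log_overlap_ratio.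
Proof.
move=> t; case E : (val t) => [[i j] k].
have /and3P[_ _ /overlap_complexP[_]] := valP t.
rewrite E /= bigcap_set3; set B := A i `&` A j `&` A k => pos.
have mB : measurable B by exact: measurableI.
have pB l : l \in [set i; j; k]%SET -> 0 < p l B by rewrite -mass_gt0//; exact: pos.
have iB : 0 < p i B by apply: pB; rewrite !inE eqxx.
have jB : 0 < p j B by apply: pB; rewrite !inE eqxx orbT.
have kB : 0 < p k B by apply: pB; rewrite !inE eqxx orbT.
rewrite /delta1 (@log_overlap_ratio_sub j k B)//; last 2 first.
- by rewrite /= E.
- by move=> x [[]].
rewrite (@log_overlap_ratio_sub i k B)//; last 2 first.
- by rewrite /= E.
- by move=> x [[]].
rewrite (@log_overlap_ratio_sub i j B)//; last 2 first.
- by rewrite /= E.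
- by move=> x [[]].
by lra.
Qed.

Hypothesis sym : overlap_positivity_symmetric ag.

Lemma H1_eq0_ur_prior : (0 < #|I|)%N -> H1_eq0 R X -> has_ur_prior ag.
Proof.
move=> I0 /(_ _ cocycle_log_overlap_ratio)[f fE].
apply: (@glued_ur_prior (fun i => expR (f i))) => // [i|]; first exact: expR_gt0.
move=> i j B mB; wlog ij : i j / (i < j)%O.
  move=> wl BD; case: (ltgtP i j) => [ij|ji|->//]; first exact: wl.
  by apply/esym; apply: wl => //; rewrite setIC.
move=> BD; set D := A i `&` A j; have mD : measurable D by exact: mAI.
have [iD|] := ltP 0 (p i D); last first.
  (* Symmetry of positivity makes a null overlap null for both agents, so both sides vanish. *)
  move=> iD; have jD : p j D <= 0.
    rewrite leNgt -mass_gt0//; apply/negP; rewrite /D setIC => /sym.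
    by rewrite setIC mass_gt0// ltNge iD.
  have z l : p l D <= 0 -> p l B = 0.
    move=> lD; apply/le_anti; rewrite mass_ge0 andbT.
    by apply: le_trans lD; exact: le_mass.
  by rewrite !z// !mulr0.
have jD : 0 < p j D by move: iD; rewrite -!mass_gt0//; exact: sym.
have ijX : is_edge X (i, j).
  rewrite /is_edge /= ij /=; apply/overlap_complexP; split.
    by apply/card_gt0P; exists i; rewrite !inE eqxx.
  by rewrite bigcap_set2 => l; rewrite !inE => /orP[]/eqP->; rewrite mass_gt0.
have := fE (Sub (i, j) ijX).
rewrite /delta0 /= => {}fE.
have wD : expR (f i) * p i D = expR (f j) * p j D.
  rewrite -[p i D]lnK ?posrE// -[p j D]lnK ?posrE// -!expRD; congr expR.
  by move: fE; rewrite /log_overlap_ratio /= -/D; lra.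
have BE := pairwise_compatible_mass iD jD mB BD; rewrite -/D in BE.
(* Equality of the weighted masses on [D] passes to [B] by compatibility, once multiplied by
   [p j D]. *)
apply: (mulIf (lt0r_neq0 jD)).
by rewrite -mulrA BE mulrCA wD; ring.
Qed.

End UrPrior.

(** * Realizing a cocycle by agents on the stars of vertices *)

Section Realization.
Context (R : realType) (disp : Order.disp_t) (I : finOrderType disp).
Variables (X : simplicial_complex I) (g : edge X -> R).
Hypothesis gZ : cocycle g.

(* A simplex is a cone over its least vertex [v], so [h i := g (v, i)] is a
   primitive of [g] on it. *)
Lemma cocycle_exact_on_simplex (J : {set I}) : J \in simplices X ->
  exists h : I -> R, forall e : edge X,
    (val e).1 \in J -> (val e).2 \in J -> g e = delta0 h e.
Proof.
move=> JX; have /card_gt0P[i0 i0J] := simplex_nonempty JX.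
case: (Order.TotalTheory.arg_minP (fun j => j) i0J) => v vJ minv.
pose h i := if insub (v, i) is Some e then g e else 0.
exists h => e iJ jJ; have hE k (e' : edge X) : val e' = (v, k) -> h k = g e'.
  by move=> e'E; rewrite /h -e'E valK.
case E : (val e) iJ jJ => [i j] /= iJ jJ.
have ijX : is_edge X (i, j) by rewrite -E; exact: valP.
have ij : (i < j)%O by case/andP: ijX.
rewrite /delta0 E /=.
have := minv i iJ; rewrite le_eqVlt => /orP[/eqP vi|vi].
  rewrite (hE j e); last by rewrite E vi.
  (* [(v, v)] is not an edge, so the default value gives [h v = 0]. *)
  rewrite /h insubN ?subr0//.
  by rewrite /is_edge /= vi ltxx.
have tX : is_triangle X (v, i, j).
  apply/and3P; split=> //=; apply: (simplex_face JX).
    by apply/fintype.subsetP => x; rewrite !inE => /orP[/orP[]|]/eqP->.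
  by apply/card_gt0P; exists v; rewrite !inE eqxx.
pose t : triangle X := Sub _ tX.
rewrite (hE j (face13 t))// (hE i (face12 t))//.
have -> : e = face23 t by apply: val_inj; rewrite E.
by have := gZ t; rewrite /delta1; lra.
Qed.

Local Notation T := (g_sigma_algebraType [set: set {set I}]).

Let measurable_all (B : set T) : measurable B.
Proof. exact: sub_sigma_algebra. Qed.
Hint Resolve measurable_all : core.

Variable h : {set I} -> I -> R.
Hypothesis hE : forall J, J \in simplices X -> forall e : edge X,
  (val e).1 \in J -> (val e).2 \in J -> g e = delta0 (h J) e.

(** Every subset of [I] is a point of [T]; those that are not simplices get weight 0. *)
Definition star_weight i (J : {set I}) : R :=
  if (J \in simplices X) && (i \in J) then expR (- h J i) else 0.

(** Dirac masses and the intersection with [setT] match the sum in [mixture]. *)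
Definition star_measure i (B : set T) : R :=
  \sum_(J : {set I}) star_weight i J * mass (\d_(J : T)) (B `&` setT).

Lemma star_weight_ge0 i J : 0 <= star_weight i J.
Proof. by rewrite /star_weight; case: ifP => // _; exact: expR_ge0. Qed.

Lemma star_weight_gt0 i J :
  (0 < star_weight i J) = (J \in simplices X) && (i \in J).
Proof. by rewrite /star_weight; case: ifP; rewrite ?expR_gt0 ?ltxx. Qed.

Lemma star_measureE i (B : set T) :
  star_measure i B = \sum_(J : {set I}) star_weight i J * (J \in B)%:R.
Proof.
by apply: eq_bigr => J _; rewrite setIT /mass /= /dirac indicE.
Qed.

Lemma star_measure_gt0 i (B : set T) : reflect
  (exists J : {set I}, [/\ J \in simplices X, i \in J & B J])
  (0 < star_measure i B).
Proof.
have term_ge0 J : true -> 0 <= star_weight i J * (J \in B)%:R.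
  by move=> _; rewrite mulr_ge0// star_weight_ge0.
rewrite star_measureE lt0r sumr_ge0// andbT psumr_neq0//.
apply: (iffP hasP) => [[J _ /=]|[J [JX iJ BJ]]].
  case: (asboolP (B J)) => BJ; last by rewrite memNset// mulr0 ltxx.
  rewrite mem_set// mulr1 star_weight_gt0 => /andP[JX iJ].
  by exists J.
exists J; first exact: mem_index_enum.
by rewrite mem_set// mulr1 /= star_weight_gt0 JX.
Qed.

Lemma star_measureT_gt0 i : 0 < star_measure i setT.
Proof.
apply/star_measure_gt0; exists [set i]%SET.
by split; rewrite ?inE//; exact: simplex_vertex.
Qed.

Definition star i : set T := [set J : {set I} | i \in J].

Lemma star_measure_star i : star_measure i (star i) = star_measure i setT.
Proof.
rewrite !star_measureE; apply: eq_bigr => J _; rewrite in_setT.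
case: (boolP (i \in J)) => iJ; first by rewrite mem_set.
by rewrite /star_weight (negbTE iJ) andbF !mul0r.
Qed.

(** At each simplex containing both ends the weights have ratio [expR (delta0 (h J) e)], which is
    [expR (g e)] whatever [J] is. *)
Lemma star_measure_ratio (e : edge X) (B : set T) :
  B `<=` star (val e).1 `&` star (val e).2 ->
  star_measure (val e).1 B = expR (g e) * star_measure (val e).2 B.
Proof.
move=> BD; rewrite !star_measureE mulr_sumr; apply: eq_bigr => J _.
case: (asboolP (B J)) => BJ; last by rewrite memNset// !mulr0.
have [iJ jJ] := BD J BJ; rewrite mem_set// !mulr1 /star_weight.
rewrite /star/= in iJ jJ; rewrite iJ jJ !andbT.
case: ifP => [JX|_]; last by rewrite mulr0.
by rewrite -expRD (hE JX)// /delta0; congr expR; lra.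
Qed.

Variable P : I -> probability T R.
Hypothesis PE : forall i (B : set T),
  mass (P i) B = star_measure i B / star_measure i setT.

Lemma star_credence i : P i (star i) = 1%E.
Proof.
by rewrite massE// PE star_measure_star divff// gt_eqF// star_measureT_gt0.
Qed.

Definition star_agents : agents R I :=
  @Agents R I _ T star P (fun i => measurable_all _) star_credence.

Lemma star_agents_gt0 i (B : set T) : reflect
  (exists J : {set I}, [/\ J \in simplices X, i \in J & B J])
  (0 < P i B)%E.
Proof.
rewrite mass_gt0// PE pmulr_lgt0 ?invr_gt0 ?star_measureT_gt0//.
exact: star_measure_gt0.
Qed.

(** The stars of the vertices of [J] meet in the sets containing [J]. A charged one is a simplex
    with [J] as a face; conversely a simplex [J] is itself a charged point. *)
Lemma star_agents_overlap_complex : overlap_complex star_agents = simplices X.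
Proof.
apply/setP => J; rewrite inE; apply/asboolP/idP => [[J0 pos]|JX].
  have /card_gt0P[j jJ] := J0.
  have /star_agents_gt0[K [KX _ JK]] := pos j jJ.
  apply: simplex_face KX _ J0; apply/fintype.subsetP => k kJ; exact: JK.
split; first exact: simplex_nonempty JX.
by move=> j jJ; apply/star_agents_gt0; exists J; split=> // k.
Qed.

Lemma star_agents_symmetric : overlap_positivity_symmetric star_agents.
Proof.
move=> i j D /star_agents_gt0[J [JX iJ [_ jJ]]].
by apply/star_agents_gt0; exists J.
Qed.

(** On an overlap the two measures differ by a constant factor, which conditionalization cancels. *)
Lemma star_agents_pairwise_compatible : pairwise_compatible star_agents.
Proof.
move=> i j; wlog ij : i j / (i < j)%O.
  move=> wl; case: (ltgtP i j) => [ij|ji|->//]; first exact: wl.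
  move=> D iD jD B mB BD; apply/esym.
  by move: iD jD BD; rewrite /D setIC => iD jD BD; apply: wl.
move=> D iD jD B mB BD; apply/conditional_eq_mass => //.
have /star_agents_gt0[J [JX _ [iJ jJ]]] := iD.
have eX : is_edge X (i, j).
  rewrite /is_edge ij /=; apply: (simplex_face JX).
    by apply/fintype.subsetP => x; rewrite !inE => /orP[]/eqP->.
  by apply/card_gt0P; exists i; rewrite !inE eqxx.
have rB := @star_measure_ratio (Sub _ eX) B BD.
have rD := @star_measure_ratio (Sub _ eX) D (@subset_refl _ _).
rewrite /= in rB rD *; rewrite !PE rB rD.
by ring.
Qed.

Lemma star_agents_ur_prior_coboundary : has_ur_prior star_agents -> coboundary g.
Proof.
move=> [Q /ur_prior_massE uQ].
(* With Z_i the total star measure, conditioning gives [star_measure i D] = Q(D) Z_i / Q(A_i). In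
   the ratio for [i] and [j] the factor Q(D) cancels, and its logarithm is [g e]. *)
exists (fun i => ln (mass Q (star i)) - ln (star_measure i setT)) => e.
case E : (val e) => [i j].
have [/= Qi iE] := uQ i; have [/= Qj jE] := uQ j.
pose D := star i `&` star j.
have := @star_measure_ratio e D; rewrite E /= => /(_ (@subset_refl _ _)).
have Zi := star_measureT_gt0 i; have Zj := star_measureT_gt0 j.
have /andP[_ eX] := valP e; rewrite E /= in eX.
have D_ij : D [set i; j]%SET by split; rewrite /star /= !inE eqxx ?orbT.
have Di : 0 < star_measure i D.
  by apply/star_measure_gt0; exists [set i; j]%SET; split; rewrite // !inE eqxx.
have Dj : 0 < star_measure j D.
  apply/star_measure_gt0; exists [set i; j]%SET.
  by split; rewrite // !inE eqxx orbT.
have QD : 0 < mass Q D.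
  have := iE D (measurable_all _) (@subIsetl _ _ _); rewrite PE => H.
  have : 0 < mass Q D / mass Q (star i) by rewrite -H divr_gt0.
  by rewrite pmulr_lgt0// invr_gt0.
have /(congr1 (@ln R)) := iE D (measurable_all _) (@subIsetl _ _ _).
have /(congr1 (@ln R)) := jE D (measurable_all _) (@subIsetr _ _ _).
rewrite !PE !ln_div ?posrE// => lj li.
move=> /(congr1 (@ln R)); rewrite lnM ?posrE ?expR_gt0// expRK.
by rewrite /delta0 E /=; lra.
Qed.

End Realization.

(** For empty [I] the conditions on pairs hold vacuously, while an ur-prior would give the empty
    union mass 1. *)
Theorem theorem1p1 (R : realType) (disp : Order.disp_t)
    (I : finOrderType disp) (I_nonempty : (0 < #|I|)%N)
    (X : simplicial_complex I) :
  (H1_eq0 R X ->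
     forall ag : agents R I, overlap_complex ag = simplices X ->
       (has_ur_prior ag <->
        pairwise_compatible ag /\ overlap_positivity_symmetric ag)) /\
  (~ H1_eq0 R X ->
     exists ag : agents R I,
       [/\ overlap_complex ag = simplices X,
           pairwise_compatible ag,
           overlap_positivity_symmetric ag
         & ~ has_ur_prior ag]).
Proof.
split=> [H1 ag agX|/existsNP[g /not_implyP[gZ g_nob]]].
  split=> [ur|[comp sym]]; last exact: H1_eq0_ur_prior H1.
  split; first exact: ur_prior_pairwise_compatible.
  exact: ur_prior_overlap_positivity_symmetric.
(* Distinct simplices are distinct points, so their primitives can be chosen independently. *)
have /choice[h hE] : forall J : {set I}, exists h : I -> R,
    J \in simplices X -> forall e : edge X,
    (val e).1 \in J -> (val e).2 \in J -> g e = delta0 h e.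
  move=> J; have [|_] := boolP (J \in simplices X).
    by move=> /(cocycle_exact_on_simplex gZ)[h hE]; exists h.
  by exists (fun=> 0).
have /choice[P PE] : forall i, exists P, forall B,
    mass P B = star_measure X h i B / star_measure X h i setT.
  move=> i; have [|P PE] := mixture (star_weight_ge0 X h i) _
      (star_measureT_gt0 X h i).
    by move=> J; exact: measurableT.
  by exists P => B; apply: PE; exact: sub_sigma_algebra.
exists (star_agents PE); split.
- exact: star_agents_overlap_complex.
- exact: (star_agents_pairwise_compatible hE).
- exact: star_agents_symmetric.
- by move=> /(star_agents_ur_prior_coboundary hE).
Qed.
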